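(* Let $\Gamma\subset\mathbb{R}^n$ be an $n$-attractor. Then both the interior $\Gamma^\circ$ and the complement $\Gamma^c=\mathbb{R}^n\setminus\Gamma$ are $E$-porous.
   Context: A domain in $\mathbb{R}^n$ means a non-empty open subset of $\mathbb{R}^n$; $B(x,r)$ denotes the closed ball of radius $r$ centred at $x$. **$n$-attractor.** An iterated function system (IFS) of contracting similarities on $\mathbb{R}^n$ is a collection $\{s_1,\ldots,s_M\}$, $M\geq 2$, of maps $s_m:\mathbb{R}^n\to\mathbb{R}^n$ such that, for some $\rho_m\in(0,1)$, $|s_m(x)-s_m(y)|=\rho_m|x-y|$ for all $x,y\in\mathbb{R}^n$. Its attractor is the unique non-empty compact set $\Gamma\subset\mathbb{R}^n$ with $\Gamma=\bigcup_{m=1}^M s_m(\Gamma)$. The IFS satisfies the open set condition (OSC) if there is a non-empty bounded open set $O\subset\mathbb{R}^n$ with $\bigcup_{m=1}^M s_m(O)\subset O$ and $s_m(O)\cap s_{m'}(O)=\emptyset$ for $m\neq m'$. A set $\Gamma\subset\mathbb{R}^n$ is an $n$-attractor if it is the attractor of an IFS of contracting similarities that satisfies the OSC and has $\sum_{m=1}^M\rho_m^n=1$. **$E$-porosity.** A domain $\Omega\subsetneqq\mathbb{R}^n$ is $E$-porous if there exists $\eta\in(0,1)$ such that for every $x\in\partial\Omega$ and $r\in(0,1)$ there exists $y\in\mathbb{R}^n$ such that $B(y,\eta r)\subset B(x,r)$ and $B(y,\eta r)\cap\overline{\Omega}=\emptyset$. *)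

(* Defs.v *)
From HB Require Import structures.
From mathcomp Require Import all_boot all_order all_algebra.
From mathcomp Require Import all_classical all_reals all_analysis.
Set Implicit Arguments.
Unset Strict Implicit.
Unset Printing Implicit Defensive.
Import Order.TTheory GRing.Theory Num.Theory.
Import numFieldNormedType.Exports.
Local Open Scope classical_set_scope.
Local Open Scope ring_scope.

(* R^n is 'rV[R]_n. The library norm `|x| on 'rV[R]_n is the sup norm, so the
   Euclidean norm is introduced separately and used for every metric notion
   (similarities, balls). Open, compact, closure, interior and bounded_set do
   not depend on the choice of norm in finite dimension, and the library's
   versions are used. *)
Definition enorm (R : realType) (n : nat) (x : 'rV[R]_n) : R :=
  Num.sqrt (\sum_(i < n) x ord0 i ^+ 2).

Definition eball (R : realType) (n : nat) (x : 'rV[R]_n) (r : R) :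
  set 'rV[R]_n := [set y | enorm (y - x) <= r].

Definition topological_boundary (T : topologicalType) (A : set T) : set T :=
  closure A `\` interior A.

Definition domain (R : realType) (n : nat) (Omega : set 'rV[R]_n) : Prop :=
  open Omega /\ Omega !=set0.

Definition contracting_similarity (R : realType) (n : nat) (rho : R)
    (s : 'rV[R]_n -> 'rV[R]_n) : Prop :=
  0 < rho < 1 /\ forall x y, enorm (s x - s y) = rho * enorm (x - y).

Definition contracting_ifs (R : realType) (n M : nat) (rho : 'I_M -> R)
    (s : 'I_M -> 'rV[R]_n -> 'rV[R]_n) : Prop :=
  (2 <= M)%N /\ forall m, contracting_similarity (rho m) (s m).

(* For a contracting IFS exactly one set satisfies this predicate. *)
Definition attractor (R : realType) (n M : nat)
    (s : 'I_M -> 'rV[R]_n -> 'rV[R]_n) (Gamma : set 'rV[R]_n) : Prop :=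
  [/\ Gamma !=set0, compact Gamma & Gamma = \bigcup_m (s m @` Gamma)].

Definition open_set_condition (R : realType) (n M : nat)
    (s : 'I_M -> 'rV[R]_n -> 'rV[R]_n) : Prop :=
  exists O : set 'rV[R]_n,
    [/\ O !=set0, bounded_set O, open O,
        \bigcup_m (s m @` O) `<=` O
      & forall m m', m != m' -> s m @` O `&` s m' @` O = set0].

Definition n_attractor (R : realType) (n : nat) (Gamma : set 'rV[R]_n) : Prop :=
  exists (M : nat) (rho : 'I_M -> R) (s : 'I_M -> 'rV[R]_n -> 'rV[R]_n),
    [/\ contracting_ifs rho s, attractor s Gamma, open_set_condition s
      & \sum_(m < M) rho m ^+ n = 1].

Definition E_porous (R : realType) (n : nat) (Omega : set 'rV[R]_n) : Prop :=
  [/\ domain Omega, Omega <> setT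
    & exists2 eta : R, 0 < eta < 1 &
      forall (x : 'rV[R]_n) (r : R), topological_boundary Omega x -> 0 < r < 1 ->
        exists2 y : 'rV[R]_n, eball y (eta * r) `<=` eball x r
          & eball y (eta * r) `&` closure Omega = set0].

(* Main.v *)
Require Import Defs.
From mathcomp Require Import all_boot all_order all_algebra.
From mathcomp Require Import all_classical all_reals all_analysis.
From mathcomp Require Import ring lra zify.
Import Order.TTheory GRing.Theory Num.Theory.
Import numFieldNormedType.Exports.
Set Implicit Arguments.
Unset Strict Implicit.
Unset Printing Implicit Defensive.
Local Open Scope classical_set_scope.
Local Open Scope ring_scope.

(** Let O be the bounded open set of the open set condition. The volume
identity sum_m rho_m^n = 1 forces the images of O to fill O: if O minus the
union of the sets s_m(closure O) contained a ball of radius r, then every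
finite packing of O by disjoint balls could be enlarged, by taking its images
under all the s_m and adding that ball, so that the sum of the n-th powers of
the radii grows by exactly r^n. Iterating contradicts the upper bound on that
sum ([packing_bound]), which is obtained by counting points of a fine grid
and so stands in for Lebesgue measure. Hence closure O is covered by its own
images, and the contraction argument that proves uniqueness of the attractor
yields Gamma = closure O ([attractor_eq_closure]). In particular Gamma has
interior points, and each tile s_v(Gamma) avoids s_w(O) when v and w are
distinct words of the same length.

Every point x of Gamma lies, for each r <= 1, in a tile of size comparable to
r, and this tile contains the image of a fixed ball of O. So B(x, r) contains
a ball of radius eta r inside O ([ball_in_open_set]). At a boundary point of
Gamma this is precisely the ball that porosity of the complement asks for.

For the interior, a hole outside Gamma is needed. Some tile s_w(Gamma) lies
inside O ([tile_in_open_set]), and O is covered by the finitely many tiles of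
words of length |w|. If x in Gamma is not interior to Gamma, then s_w(x) is not
interior to s_w(Gamma), and therefore belongs to another tile s_v(Gamma)
([neighbour_tile]). Pulling back by s_w, the set Gamma is surrounded by
finitely many copies of itself, each point of its boundary lies on one of
them, and the balls found inside that copy are disjoint from Gamma. Only
finitely many copies occur, so the porosity constant is uniform.

Pulling back requires similarities to be onto, which is not part of their
definition: a Euclidean isometry fixing 0 preserves inner products, hence is
multiplication by an orthogonal matrix ([similarity_inverse]). *)

(** * The Euclidean norm and similarities *)

Section Euclid.
Variables (R : realType) (n : nat).
Implicit Types (x y u v : 'rV[R]_n) (A B : set 'rV[R]_n).

Lemma enorm_ge0 x : 0 <= enorm x.
Proof. exact: sqrtr_ge0. Qed.

Definition dot u v : R := \sum_(i < n) u ord0 i * v ord0 i.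

Lemma enorm_sqr x : enorm x ^+ 2 = dot x x.
Proof.
rewrite sqr_sqrtr; first by apply: eq_bigr => i _; rewrite expr2.
by apply: sumr_ge0 => i _; exact: sqr_ge0.
Qed.

Lemma dot_polar u v : dot (u - v) (u - v) = dot u u + dot v v - dot u v *+ 2.
Proof.
rewrite /dot -sumrMnl -big_split -sumrB; apply: eq_bigr => i _ /=.
by rewrite !mxE; ring.
Qed.

Lemma dot_delta u i : dot u (delta_mx ord0 i) = u ord0 i.
Proof.
rewrite /dot (bigD1 i)//= mxE !eqxx mulr1 big1 ?addr0// => j ji.
by rewrite mxE (negbTE ji) andbF mulr0.
Qed.

Lemma norm_rV_leP x (h : R) : 0 <= h ->
  reflect (forall i, `|x ord0 i| <= h) (`|x| <= h).
Proof.
move=> h0; rewrite /Num.norm/= mx_normrE; apply: (iffP idP) => [xh i|xh].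
  apply: le_trans xh.
  exact: (le_bigmax_cond _ (fun ij : 'I_1 * 'I_n => `|x ij.1 ij.2|)
            (j := (ord0, i))).
apply: bigmax_le => // -[i j] _ /=; rewrite ord1; exact: xh.
Qed.

Lemma coord_le_enorm x i : `|x ord0 i| <= enorm x.
Proof.
rewrite -[leLHS]sqrtr_sqr ler_sqrt ?sqr_ge0//; last first.
  by apply: sumr_ge0 => j _; exact: sqr_ge0.
rewrite (bigD1 i)//= lerDl.
by apply: sumr_ge0 => j _; exact: sqr_ge0.
Qed.

Lemma norm_le_enorm x : `|x| <= enorm x.
Proof. by apply/norm_rV_leP; [exact: enorm_ge0|exact: coord_le_enorm]. Qed.

Lemma enorm_le_norm x : enorm x <= n%:R * `|x|.
Proof.
rewrite -[leRHS]ger0_norm ?mulr_ge0// -sqrtr_sqr ler_sqrt ?sqr_ge0//.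
have hx i : x ord0 i ^+ 2 <= `|x| ^+ 2.
  rewrite -[leLHS]real_normK ?num_real// lerXn2r ?nnegrE//.
  by apply/norm_rV_leP.
apply: (le_trans (ler_sum _ (fun i _ => hx i))).
rewrite sumr_const card_ord exprMn -(mulr_natl (`|x| ^+ 2)) ler_wpM2r ?sqr_ge0//.
rewrite -natrX ler_nat; nia.
Qed.

(** Links the Euclidean balls to the topology, which is that of the sup norm. *)
Lemma nbhs_eballP x A :
  nbhs x A <-> exists2 r : R, 0 < r & eball x r `<=` A.
Proof.
split=> [/nbhs_ballP[r/= r0 rA]|[r r0 rA]].
  exists (r / 2); first by rewrite divr_gt0.
  move=> y; rewrite /eball/= => yx; apply: rA; rewrite -ball_normE/=.
  rewrite distrC; apply: le_lt_trans (norm_le_enorm _) _.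
  by apply: le_lt_trans yx _; rewrite ltr_pdivrMr// ltr_pMr// ltr1n.
apply/nbhs_ballP; exists (r / n.+1%:R) => /=; first by rewrite divr_gt0.
move=> y; rewrite -ball_normE/= distrC => yx; apply: rA.
rewrite /eball/=; apply: le_trans (enorm_le_norm _) _.
rewrite ltr_pdivlMr// in yx; apply: ltW; apply: le_lt_trans yx.
by rewrite mulrC ler_wpM2l// ler_nat.
Qed.

Definition similarity (rho : R) (s : 'rV[R]_n -> 'rV[R]_n) : Prop :=
  0 < rho /\ forall x y, enorm (s x - s y) = rho * enorm (x - y).

Lemma similarity_id : similarity 1 id.
Proof. by split=> // x y; rewrite mul1r. Qed.

Lemma similarity_comp a b s t :
  similarity a s -> similarity b t -> similarity (a * b) (s \o t).
Proof.
by case=> a0 hs [b0 ht]; split=> [|x y]; rewrite ?mulr_gt0//= hs ht mulrA.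
Qed.

(** After normalizing, a similarity becomes an isometry f with f 0 = 0.
Polarization gives dot (f x) (f y) = dot x y, so the matrix F whose rows are
the images of the unit vectors satisfies F F^T = 1; being square it also
satisfies F^T F = 1, and f x = x F is invertible. *)
Lemma similarity_inverse rho s : similarity rho s ->
  exists g, [/\ cancel s g, cancel g s & similarity rho^-1 g].
Proof.
move=> [rho0 hs]; have rhoN0 : rho != 0 by rewrite gt_eqF.
suff [g [sg gs]] : exists g, cancel s g /\ cancel g s.
  exists g; split=> //; split=> [|x y]; first by rewrite invr_gt0.
  by rewrite -{2}(gs x) -{2}(gs y) hs mulKf.
pose f x := rho^-1 *: (s x - s 0).
have fB x y : dot (f x - f y) (f x - f y) = dot (x - y) (x - y).
  have -> : f x - f y = rho^-1 *: (s x - s y).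
    by rewrite /f -scalerBr opprB addrA addrNK.
  have hZ u : dot (rho^-1 *: u) (rho^-1 *: u) = rho^-1 ^+ 2 * dot u u.
    rewrite /dot mulr_sumr; apply: eq_bigr => i _; rewrite !mxE; ring.
  by rewrite hZ -!enorm_sqr hs exprMn mulrA -exprMn mulVf// expr1n mul1r.
have f0 : f 0 = 0 by rewrite /f subrr scaler0.
have fn x : dot (f x) (f x) = dot x x.
  by have := fB x 0; rewrite f0 !subr0.
have fd x y : dot (f x) (f y) = dot x y.
  have := fB x y; rewrite !dot_polar !fn => /addrI/oppr_inj/eqP.
  by rewrite eqrMn2r => /= /eqP.
pose F := \matrix_(i < n, j < n) f (delta_mx ord0 i) ord0 j.
have fF x : f x *m F^T = x.
  apply/rowP => j; rewrite !mxE -[RHS]dot_delta -fd.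
  by apply: eq_bigr => k _; rewrite !mxE.
have FF : F *m F^T = 1%:M.
  apply/matrixP => i j; rewrite !mxE.
  transitivity (dot (f (delta_mx ord0 i)) (f (delta_mx ord0 j))).
    by apply: eq_bigr => k _; rewrite !mxE.
  by rewrite fd dot_delta mxE eqxx eq_sym.
have fE x : f x = x *m F by rewrite -{2}(fF x) -mulmxA (mulmx1C FF) mulmx1.
have sE x : s x = s 0 + rho *: f x.
  by rewrite /f scalerA mulfV// scale1r addrC subrK.
exists (fun y => (rho^-1 *: (y - s 0)) *m F^T); split=> [x|y]; first exact: fF.
rewrite sE fE -mulmxA (mulmx1C FF) mulmx1 scalerA mulfV// scale1r.
by rewrite addrC subrK.
Qed.

End Euclid.

(** * A volume bound for packings of balls *)

Section Packing.
Variables (R : realType) (n : nat).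
Hypothesis n_gt0 : (0 < n)%N.

Lemma sum_card_disjoint (I T : finType) (A : I -> {pred T}) :
  (forall i j x, x \in A i -> x \in A j -> i = j) ->
  (\sum_i #|A i| <= #|T|)%N.
Proof.
move=> disj; under eq_bigr do rewrite -sum1_card big_mkcond/=.
rewrite exchange_big /= -sum1_card; apply: leq_sum => x _.
case: (pickP (fun i => x \in A i)) => [i xi|none]; last first.
  by rewrite big1// => i _; rewrite none.
rewrite (bigD1 i)//= big1 ?addn0; first by case: ifP.
move=> j ji; case: ifP => // xj.
by rewrite (disj _ _ _ xj xi) eqxx in ji.
Qed.

(** An interval of length l contains at least the integer part of l integers,
and this is at least l / 2 as soon as l >= 2; the loss of a factor 2 is
harmless because each ball offers an interval twice as long as needed. *)
Lemma card_grid_interval (K : nat) (u v : R) : 0 <= u -> v < K%:R ->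
  2 <= v - u -> (v - u) / 2 <= #|[pred a : 'I_K | u <= a%:R <= v]|%:R.
Proof.
move=> u0 vK uv; pose k := Num.truncn (v - u).
have vu0 : 0 <= v - u by lra.
have /andP[kl ku] : k%:R <= v - u < k.+1%:R by exact: truncn_itv.
pose m := Num.truncn u.
have /andP[ml mu] : m%:R <= u < m.+1%:R by exact: truncn_itv.
have bd (a : 'I_k) : u <= (m.+1 + a)%:R <= v.
  have : (a.+1)%:R <= k%:R :> R by rewrite ler_nat.
  rewrite natrD -[a.+1]addn1 -[m.+1]addn1 !natrD in mu *.
  by move=> ak; apply/andP; split; [have := ler0n R a|]; lra.
have mK (a : 'I_k) : (m.+1 + a < K)%N.
  by rewrite -(ltr_nat R); case/andP: (bd a) => _ /le_lt_trans; exact.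
pose g (a : 'I_k) : 'I_K := Ordinal (mK a).
have ginj : injective g by move=> a b /(congr1 val)/= /addnI/val_inj.
apply: (@le_trans _ _ k%:R).
  by rewrite -[k.+1]addn1 natrD in ku; lra.
rewrite ler_nat -[k in (k <= _)%N]card_ord -(card_imset _ ginj).
apply/subset_leq_card/fintype.subsetP => _ /imsetP[a _ ->].
by rewrite inE; exact: bd.
Qed.

(** A substitute for comparing volumes. Put a grid of mesh 1/N on the cube
[-L, L]^n. A ball of radius t contains a cube of half-side h = t / n, hence at
least (N h)^n grid points once N h >= 1; the grid has (2LN + 1)^n points, and
disjoint balls share none of them. The factors N^n cancel. *)
Lemma packing_bound (I : finType) (c : I -> 'rV[R]_n) (t : I -> R) (L : nat) :
  (forall i, 0 < t i) ->
  (forall i, eball (c i) (t i) `<=` [set y | `|y| <= L%:R]) ->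
  (forall i j, i != j -> eball (c i) (t i) `&` eball (c j) (t j) = set0) ->
  \sum_i t i ^+ n <= (n%:R * (L.*2.+1)%:R) ^+ n.
Proof.
move=> t0 tL disj.
have nR0 : 0 < n%:R :> R by rewrite ltr0n.
pose h i := t i / n%:R.
have h0 i : 0 < h i by rewrite divr_gt0.
have cube i (y : 'rV[R]_n) : (forall j, `|y ord0 j - c i ord0 j| <= h i) ->
    eball (c i) (t i) y.
  move=> yh; rewrite /eball/=; apply: le_trans (enorm_le_norm _) _.
  rewrite mulrC -ler_pdivlMr//; apply/norm_rV_leP; first exact: ltW (h0 i).
  by move=> j; rewrite !mxE; exact: yh.
(* The extreme points of the inscribed cubes lie in the balls, hence in
   [-L, L]^n, so that no grid index leaves the range 0 .. 2LN. *)
have corner i j : - L%:R <= c i ord0 j - h i /\ c i ord0 j + h i <= L%:R.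
  have H (y : 'rV[R]_n) :
      (forall k, `|y ord0 k - c i ord0 k| <= h i) -> `|y ord0 j| <= L%:R.
    by move=> /cube/tL/=/norm_rV_leP; apply.
  have := H (c i - const_mx (h i)); have := H (c i + const_mx (h i)).
  rewrite !mxE => H1 H2; split.
    suff : `|c i ord0 j - h i| <= L%:R by rewrite ler_norml => /andP[].
    by apply: H2 => k; rewrite !mxE addrAC subrr add0r normrN gtr0_norm.
  suff : `|c i ord0 j + h i| <= L%:R by rewrite ler_norml => /andP[].
  by apply: H1 => k; rewrite !mxE addrAC subrr add0r gtr0_norm.
pose N := (\max_i Num.truncn (h i)^-1).+1.
have N0 : 0 < N%:R :> R by rewrite ltr0n.
have Nh i : 1 <= N%:R * h i.
  rewrite -ler_pdivrMr// div1r; apply: ltW; apply: lt_le_trans (truncnS_gt _) _.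
  by rewrite ler_nat ltnS (bigop.leq_bigmax i).
pose K := (L.*2 * N).+1.
pose u i j := N%:R * (c i ord0 j - h i + L%:R).
pose v i j := N%:R * (c i ord0 j + h i + L%:R).
pose J i j := [pred a : 'I_K | u i j <= a%:R <= v i j].
have uvE i j : (v i j - u i j) / 2 = N%:R * h i by rewrite /u /v; field.
have cardJ i j : N%:R * h i <= #|J i j|%:R.
  rewrite -(uvE i j); apply: card_grid_interval.
  - by apply: mulr_ge0 => //; have [] := corner i j; lra.
  - rewrite /K -addn1 -mul2n natrD !natrM mulrC.
    have := ler_wpM2r (ltW N0) (proj2 (corner i j)).
    by rewrite /v; nra.
  - by have := Nh i; rewrite -(uvE i j); lra.
have cardF i : (N%:R * h i) ^+ n <= #|family (J i)|%:R.
  rewrite card_family foldrE big_image/= natr_prod.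
  rewrite -[X in _ ^+ X](card_ord n) -prodr_const.
  by apply: ler_prod => j _; rewrite cardJ andbT mulr_ge0// ltW.
have disjF i j (f : {ffun 'I_n -> 'I_K}) :
    f \in family (J i) -> f \in family (J j) -> i = j.
  pose y := \row_k (((f k)%:R : R) / N%:R - L%:R).
  have H m : f \in family (J m) -> eball (c m) (t m) y.
    move=> /familyP fm; apply: cube => k; have := fm k.
    rewrite inE /u /v !(mulrC N%:R) => /andP[].
    rewrite -ler_pdivlMr// => le_l; rewrite -ler_pdivrMr// => le_r.
    by rewrite /y !mxE ler_norml; apply/andP; split; lra.
  move=> /H yi /H yj; apply/eqP/negP => /negP /disj ij.
  by have : (eball (c i) (t i) `&` eball (c j) (t j)) y by []; rewrite ij.
have total : N%:R ^+ n * (\sum_i h i ^+ n) <= (K ^ n)%:R.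
  rewrite mulr_sumr; under eq_bigr do rewrite -exprMn.
  apply: (le_trans (ler_sum _ (fun i _ => cardF i))).
  rewrite -natr_sum ler_nat -[X in (K ^ X)%N](card_ord n).
  by rewrite -[X in (X ^ _)%N](card_ord K) -card_ffun; exact: sum_card_disjoint disjF.
have KN : (K <= N * L.*2.+1)%N by rewrite /K; nia.
have hE : \sum_i t i ^+ n = n%:R ^+ n * \sum_i h i ^+ n.
  rewrite mulr_sumr; apply: eq_bigr => i _.
  by rewrite -exprMn /h mulrC divfK// gt_eqF.
rewrite hE exprMn ler_pM2l ?exprn_gt0// -(ler_pM2l (exprn_gt0 n N0)).
apply: le_trans total _; rewrite -exprMn natrX -natrM.
by rewrite lerXn2r ?nnegrE// ler_nat.
Qed.

End Packing.

(** * Topology of similarities *)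

Section SimilarityTopology.
Variables (R : realType) (n : nat).
Implicit Types (x y : 'rV[R]_n) (A B : set 'rV[R]_n).

Lemma similarity_continuous (rho : R) (s : 'rV[R]_n -> 'rV[R]_n) :
  similarity rho s -> continuous s.
Proof.
move=> [rho0 hs] x B /nbhs_eballP[r r0 rB]; apply/nbhs_eballP.
exists (r / rho); first by rewrite divr_gt0.
by move=> y yx; apply: rB; rewrite /eball/= hs mulrC -ler_pdivlMr.
Qed.

Lemma similarity_ball (rho : R) (s : 'rV[R]_n -> 'rV[R]_n) c r :
  similarity rho s -> s @` eball c r = eball (s c) (rho * r).
Proof.
move=> simS; have [g [_ gs _]] := similarity_inverse simS.
case: simS => rho0 hs; rewrite predeqE => y; split=> [[x xc <-]|yc].
  by rewrite /eball/= hs ler_pM2l.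
by exists (g y) => //; rewrite /eball/= -(ler_pM2l rho0) -hs gs.
Qed.

Lemma similarity_image_preimage (rho : R) (s : 'rV[R]_n -> 'rV[R]_n) :
  similarity rho s ->
  exists2 g, continuous g & forall A, s @` A = g @^-1` A.
Proof.
move=> /similarity_inverse[g [sg gs simg]]; exists g.
  exact: similarity_continuous simg.
move=> A; rewrite predeqE => y; split=> [[x Ax <-]|Ay].
  by rewrite /preimage/= sg.
by exists (g y).
Qed.

Lemma similarity_open (rho : R) s A : similarity rho s -> open A -> open (s @` A).
Proof.
move=> /similarity_image_preimage[g cg ->] oA.
by apply: open_comp => // x _; exact: cg.
Qed.

Lemma similarity_closed (rho : R) s A :
  similarity rho s -> closed A -> closed (s @` A).
Proof.
move=> /similarity_image_preimage[g cg ->] cA.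
by apply: closed_comp => // x _; exact: cg.
Qed.

Lemma image_closure_subset (rho : R) s A : similarity rho s ->
  s @` closure A `<=` closure (s @` A).
Proof.
move=> /similarity_continuous cs _ [x clx <-] B /cs sB.
by have [y [Ay By]] := clx _ sB; exists (s y); split => //; exists y.
Qed.

Lemma open_disjoint_closure (T : topologicalType) (U V : set T) :
  open U -> U `&` V = set0 -> U `&` closure V = set0.
Proof.
move=> oU UV; rewrite predeqE => x; split=> // -[Ux clx].
have [y [Vy Uy]] := clx _ (open_nbhs_nbhs (conj oU Ux)).
by have : (U `&` V) y by []; rewrite UV.
Qed.

End SimilarityTopology.

(** * The images of the open set fill it *)

Section OpenSetFill.
Variables (R : realType) (n M : nat) (rho : 'I_M -> R).
Variables (s : 'I_M -> 'rV[R]_n -> 'rV[R]_n) (O : set 'rV[R]_n).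
Hypothesis sim : forall m, similarity (rho m) (s m).
Hypothesis n_gt0 : (0 < n)%N.
Hypothesis sum1 : \sum_m rho m ^+ n = 1.
Hypothesis bddO : bounded_set O.
Hypothesis openO : open O.
Hypothesis sO : \bigcup_m (s m @` O) `<=` O.
Hypothesis disjO : forall m m', m != m' -> s m @` O `&` s m' @` O = set0.

Definition packs (I : finType) (c : I -> 'rV[R]_n) (t : I -> R) : Prop :=
  [/\ forall i, 0 < t i, forall i, eball (c i) (t i) `<=` O
    & forall i j, i != j -> eball (c i) (t i) `&` eball (c j) (t j) = set0].

(** The images of a packing under all the s_m have total n-th power
(sum_m rho_m^n) * S = S, so a ball avoiding these images comes as a pure gain.
The new packing is indexed by one extra point and the pairs (m, i). *)
Lemma packing_step b r : 0 < r -> eball b r `<=` O ->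
    (forall m, eball b r `&` s m @` O = set0) ->
  forall (I : finType) c t, @packs I c t ->
  exists (J : finType) c' t', @packs J c' t' /\
    \sum_j t' j ^+ n = r ^+ n + \sum_i t i ^+ n.
Proof.
move=> r0 bO bs I c t [t0 tO disj].
pose J : finType := (unit + 'I_M * I)%type.
pose c' (j : J) := match j with inl _ => b | inr p => s p.1 (c p.2) end.
pose t' (j : J) := match j with inl _ => r | inr p => rho p.1 * t p.2 end.
have imB m i : eball (s m (c i)) (rho m * t i) = s m @` eball (c i) (t i).
  by rewrite (similarity_ball _ _ (sim m)).
have imO m i : eball (s m (c i)) (rho m * t i) `<=` s m @` O.
  by rewrite imB; apply: image_subset; exact: tO.
have disj_sym (A B : set 'rV[R]_n) : (forall x, A x -> B x -> False) ->
    A `&` B = set0.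
  by move=> AB; rewrite predeqE => x; split=> // -[]; exact: AB.
have meet0 (A B : set 'rV[R]_n) x : A `&` B = set0 -> A x -> B x -> False.
  by move=> AB Ax Bx; have : (A `&` B) x by []; rewrite AB.
exists J, c', t'; split; first split.
- by case=> [_|[m i]] //=; rewrite mulr_gt0//; have [] := sim m.
- case=> [_|[m i]] //= x /imO mx; apply: sO; exists m => //.
- move=> [[]|[m i]] [[]|[m' i']] //= ij; apply: disj_sym => x.
  + by move=> xb /imO xm; exact: meet0 (bs m') xb xm.
  + by move=> /imO xm xb; exact: meet0 (bs m) xb xm.
  + have [mm'|mm'] := eqVneq m m'; last first.
      by move=> /imO xm /imO xm'; exact: meet0 (disjO mm') xm xm'.
    subst m'; have ii' : i != i' by apply: contra ij => /eqP ->.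
    rewrite !imB => -[y yi <-] [y' yi' yy'].
    have [g [sg _ _]] := similarity_inverse (sim m).
    have e : y' = y by rewrite -(sg y') yy' sg.
    by rewrite e in yi'; exact: meet0 (disj _ _ ii') yi yi'.
rewrite big_sumType/= (big_pred1 tt)//=.
congr (_ + _); rewrite -(pair_bigA _ (fun m i => (rho m * t i) ^+ n))/=.
under eq_bigr do (under eq_bigr do rewrite exprMn; rewrite -mulr_sumr).
by rewrite -mulr_suml sum1 mul1r.
Qed.

(** Otherwise [packing_step] applies repeatedly with one fixed ball, starting
from the empty packing, and the sums K r^n are unbounded in K, against
[packing_bound]. *)
Lemma open_set_filled : O `<=` \bigcup_m (s m @` closure O).
Proof.
have clU : closed (\bigcup_m (s m @` closure O)).
  apply: closed_bigcup => [|m _]; first exact: finite_finset.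
  by apply: similarity_closed (sim m) _; exact: closed_closure.
apply: contrapT => /existsNP[b /not_implyP[Ob nb]].
have /nbhs_eballP[r r0 rU] : nbhs b (O `&` ~` \bigcup_m (s m @` closure O)).
  by apply: open_nbhs_nbhs; split=> //; apply: openI => //; exact: closed_openC.
have bO : eball b r `<=` O by move=> x /rU[].
have bs m : eball b r `&` s m @` O = set0.
  rewrite predeqE => x; split=> // -[/rU[_ nx] [y Oy yx]]; apply: nx.
  by exists m => //; exists y => //; exact: subset_closure.
have packK (K : nat) : exists (J : finType) c t, @packs J c t /\
    \sum_j t j ^+ n = K%:R * r ^+ n.
  elim: K => [|K [I [c [t [pk e]]]]].
    exists void, (fun=> b), (fun=> r); split; first by split; case.
    by rewrite big1 ?mul0r//; case.
  have [J [c' [t' [pk' e']]]] := packing_step r0 bO bs pk.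
  by exists J, c', t'; split=> //; rewrite e' e -natr1 mulrDl mul1r addrC.
have [B _ OB] := ex_strict_bound_gt0 bddO.
pose C : R := (n%:R * (((Num.truncn B).+1).*2.+1)%:R) ^+ n.
have KC (K : nat) : K%:R <= C / r ^+ n.
  have [J [c [t [[t0 tO tdisj] e]]]] := packK K.
  rewrite ler_pdivlMr ?exprn_gt0// -e;
  apply: (packing_bound n_gt0 t0 _ tdisj) => i x xi.
  by apply: ltW; apply: lt_trans (truncnS_gt B); exact: OB (tO i x xi).
by have := KC (Num.truncn (C / r ^+ n)).+1; rewrite leNgt truncnS_gt.
Qed.

End OpenSetFill.

(** * Words in the maps of an iterated function system *)

Section Words.
Variables (R : realType) (n M : nat) (rho : 'I_M -> R).
Variable s : 'I_M -> 'rV[R]_n -> 'rV[R]_n.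
Hypothesis sim : forall m, similarity (rho m) (s m).
Hypothesis rho_lt1 : forall m, rho m < 1.
Implicit Types (A B : set 'rV[R]_n) (w : seq 'I_M).

Definition word_map w : 'rV[R]_n -> 'rV[R]_n :=
  foldr (fun m f => s m \o f) id w.

Definition word_ratio w : R := \prod_(m <- w) rho m.

Lemma word_similarity w : similarity (word_ratio w) (word_map w).
Proof.
elim: w => [|m w IH]; rewrite /word_ratio ?big_nil ?big_cons/=.
  exact: similarity_id.
exact: similarity_comp.
Qed.

Lemma word_map_rcons w m x : word_map (rcons w m) x = word_map w (s m x).
Proof. by elim: w => //= a w ->. Qed.

Lemma word_ratio_rcons w m : word_ratio (rcons w m) = word_ratio w * rho m.
Proof. by rewrite /word_ratio -cats1 big_cat big_seq1. Qed.

Lemma word_ratio_le1 w : word_ratio w <= 1.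
Proof.
rewrite /word_ratio; elim: w => [|m w IH]; rewrite ?big_nil ?big_cons//.
apply: mulr_ile1 => //; last exact: ltW.
  by have [/ltW] := sim m.
by have [/ltW] := word_similarity w.
Qed.

Lemma word_ratio_ge (p : R) w : 0 <= p -> (forall m, p <= rho m) ->
  p ^+ size w <= word_ratio w.
Proof.
move=> p0 prho; rewrite /word_ratio; elim: w => [|m w IH].
  by rewrite big_nil expr0.
by rewrite big_cons/= exprS ler_pM// exprn_ge0.
Qed.

Lemma word_map_stable A w : \bigcup_m (s m @` A) `<=` A ->
  word_map w @` A `<=` A.
Proof.
move=> sA; elim: w => [|m w IH] y [x Ax <-] //=.
by apply: sA; exists m => //; exists (word_map w x) => //; apply: IH; exists x.
Qed.

Lemma word_cover A k x : A `<=` \bigcup_m (s m @` A) -> A x ->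
  exists2 w, size w = k & (word_map w @` A) x.
Proof.
move=> sA; elim: k x => [|k IH] x Ax; first by exists [::] => //; exists x.
have [m _ [y Ay <-]] := sA x Ax; have [w <- [z Az <-]] := IH y Ay.
by exists (m :: w) => //; exists z.
Qed.

Lemma finite_pos_lower_bound (I : finType) (F : I -> R) :
  (forall i, 0 < F i) -> exists p, [/\ 0 < p, p <= 1 & forall i, p <= F i].
Proof.
move=> F0; exists (\big[Num.min/1]_i F i); split.
- by apply/bigmin_gtP.
- exact: bigmin_le_id.
- by move=> i; exact: bigmin_le_cond.
Qed.

(** Extend the word letter by letter, following x, and stop at the first ratio
not exceeding r: one step multiplies the ratio by at least p, so it cannot
drop below p r. *)
Lemma word_stop A (p r : R) x : A `<=` \bigcup_m (s m @` A) ->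
    0 <= p <= 1 -> (forall m, p <= rho m) -> 0 < r <= 1 -> A x ->
  exists2 w, (word_map w @` A) x & p * r <= word_ratio w <= r.
Proof.
move=> sA /andP[p0 p1] prho /andP[r0 r1] Ax.
(* 1 - q bounds all the ratios away from 1, which makes the process stop. *)
have [q [q0 q1 qrho]] : exists q, [/\ 0 < q, q <= 1 & forall m, q <= 1 - rho m].
  by apply: finite_pos_lower_bound => m; rewrite subr_gt0.
have step k : exists2 w, (word_map w @` A) x &
    p * r <= word_ratio w /\ (word_ratio w <= r \/ word_ratio w <= (1 - q) ^+ k).
  elim: k => [|k [w [y Ay yx] [pw [wr|wk]]]].
  - exists [::]; first by exists x.
    by rewrite /word_ratio big_nil expr0; split; [rewrite mulr_ile1// ltW|right].
  - by exists w; [exists y|split=> //; left].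
  have [wr|rw] := lerP (word_ratio w) r.
    by exists w; [exists y|split=> //; left].
  have [m _ [z Az zy]] := sA y Ay; exists (rcons w m).
    by exists z => //; rewrite word_map_rcons zy.
  have rho0 : 0 < rho m by have [] := sim m.
  have rhoq : rho m <= 1 - q by have := qrho m; lra.
  rewrite word_ratio_rcons; split; last right.
    by rewrite mulrC ler_pM// ltW.
  by rewrite exprSr ler_pM// ltW// (lt_trans r0).
have [k kr] : exists k, (1 - q) ^+ k <= r.
  have : (fun k => (1 - q) ^+ k) @ \oo --> (0 : R).
    by apply: cvg_expr; rewrite ger0_norm; lra.
  move=> /cvgr0_norm_le /(_ r r0)[k _ /(_ k (leqnn k))/= kr].
  by exists k; apply: le_trans kr; exact: ler_norm.
have [w wx [pw wr]] := step k; exists w => //; rewrite pw/=.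
by case: wr => // /le_trans; exact.
Qed.

(** The images are separated at the first letter where the words differ. *)
Lemma word_disjoint A v w x y : \bigcup_m (s m @` A) `<=` A ->
    (forall m m', m != m' -> s m @` A `&` s m' @` A = set0) ->
  A x -> A y -> size v = size w -> word_map v x = word_map w y -> v = w.
Proof.
move=> sA disjA Ax Ay; elim: v w => [|a v IH] [|b w]//= [vw].
have Av : A (word_map v x) by apply: (word_map_stable (w := v)) => //; exists x.
have Aw : A (word_map w y) by apply: (word_map_stable (w := w)) => //; exists y.
move=> e; have [ab|ab] := eqVneq a b; last first.
  have : (s a @` A `&` s b @` A) (s a (word_map v x)).
    by split; [exists (word_map v x)|rewrite e; exists (word_map w y)].
  by rewrite disjA.
subst b; have [g [sg _ _]] := similarity_inverse (sim a).
by rewrite (IH w)// -[LHS]sg e sg.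
Qed.

Lemma bounded_distance A B : bounded_set A -> bounded_set B ->
  exists2 D : R, 1 <= D & forall a b, A a -> B b -> enorm (a - b) <= D.
Proof.
move=> /ex_strict_bound_gt0[C C0 AC] /ex_strict_bound_gt0[E E0 BE].
exists (n%:R * (C + E) + 1) => [|a b /AC/= aC /BE/= bE].
  by rewrite lerDr mulr_ge0// addr_ge0// ltW.
apply: le_trans (enorm_le_norm _) _; apply: (@le_trans _ _ (n%:R * (C + E))).
  by rewrite ler_wpM2l//; apply: le_trans (ler_normB _ _) _; lra.
by rewrite lerDl.
Qed.

(** Uniqueness of attractors, split into one-sided hypotheses: a point of A lies
in arbitrarily small images of A, and the same words map a point of B to a
nearby point of B. *)
Lemma self_covering_subset A B : A `<=` \bigcup_m (s m @` A) -> bounded_set A ->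
  B !=set0 -> closed B -> bounded_set B -> \bigcup_m (s m @` B) `<=` B ->
  A `<=` B.
Proof.
move=> sA bA [b Bb] clB bB sB x Ax; apply: clB => U /nbhs_eballP[e e0 eU].
have [D D1 hD] := bounded_distance bB bA.
have D0 : 0 < D by lra.
have r0 : 0 < Num.min 1 (e / D) <= 1.
  by rewrite lt_min ltr01 divr_gt0// ge_min lexx.
(* Only the upper bound on the ratio matters here, hence p = 0. *)
have := word_stop (p := 0) sA _ _ r0 Ax; case=> [|m|w [a Aa wx] /andP[_ wr]].
- by rewrite lexx ler01.
- by have [/ltW] := sim m.
exists (word_map w b); split.
  by apply: (word_map_stable (w := w)) => //; exists b.
apply: eU; rewrite /eball/= -wx; have [w0 ->] := word_similarity w.
have we : word_ratio w <= e / D by apply: le_trans wr _; rewrite ge_min lexx orbT.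
apply: (@le_trans _ _ (e / D * D)); last by rewrite divfK// gt_eqF.
by apply: ler_pM => //; [exact: ltW|exact: enorm_ge0|exact: hD].
Qed.

End Words.

Lemma bounded_closure (R : realType) (n : nat) (A : set 'rV[R]_n) :
  bounded_set A -> bounded_set (closure A).
Proof.
move=> /ex_strict_bound_gt0[C _ AC]; exists C; split; first exact: num_real.
have cl : closed [set x : 'rV[R]_n | `|x| <= C].
  apply: (@closed_comp _ _ (fun x : 'rV[R]_n => `|x|) [set y | y <= C]).
    by move=> x _; exact: norm_continuous.
  exact: closed_le.
move=> D CD x clx; apply: (@le_trans _ _ C); last exact: ltW.
by apply: cl; apply: closure_subset clx => y /AC /ltW.
Qed.

(** * Porosity of the interior and of the complement *)

Section Porosity.
Variables (R : realType) (n M : nat) (rho : 'I_M -> R).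
Variables (s : 'I_M -> 'rV[R]_n -> 'rV[R]_n) (O Gamma : set 'rV[R]_n).
Hypothesis sim : forall m, similarity (rho m) (s m).
Hypothesis rho_lt1 : forall m, rho m < 1.
Hypothesis n_gt0 : (0 < n)%N.
Hypothesis sum1 : \sum_m rho m ^+ n = 1.
Hypothesis O_neq0 : O !=set0.
Hypothesis bddO : bounded_set O.
Hypothesis openO : open O.
Hypothesis sO : \bigcup_m (s m @` O) `<=` O.
Hypothesis disjO : forall m m', m != m' -> s m @` O `&` s m' @` O = set0.
Hypothesis Gamma_neq0 : Gamma !=set0.
Hypothesis bddG : bounded_set Gamma.
Hypothesis closedG : closed Gamma.
Hypothesis GammaE : Gamma = \bigcup_m (s m @` Gamma).

Let sGamma : \bigcup_m (s m @` Gamma) `<=` Gamma.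
Proof. by rewrite -GammaE. Qed.

Let Gammas : Gamma `<=` \bigcup_m (s m @` Gamma).
Proof. by rewrite -GammaE. Qed.

Lemma closure_open_set_stable : \bigcup_m (s m @` closure O) `<=` closure O.
Proof.
move=> x [m _ /(image_closure_subset (sim m))]; apply: closure_subset.
by move=> y my; apply: sO; exists m.
Qed.

(** The two sets are compared by uniqueness of attractors; that closure O is
covered by its images is where the volume identity enters. *)
Lemma attractor_eq_closure : Gamma = closure O.
Proof.
rewrite eqEsubset; split.
  apply: (self_covering_subset sim rho_lt1) => //.
  - by have [b Ob] := O_neq0; exists b; exact: subset_closure.
  - exact: closed_closure.
  - exact: bounded_closure.
  - exact: closure_open_set_stable.
apply: (self_covering_subset sim rho_lt1) => //; last exact: bounded_closure.
have clU : closed (\bigcup_m (s m @` closure O)).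
  apply: closed_bigcup => [|m _]; first exact: finite_finset.
  by apply: similarity_closed (sim m) _; exact: closed_closure.
move=> x clx; apply: clU; apply: closure_subset clx.
exact: (open_set_filled sim n_gt0 sum1 bddO openO sO disjO).
Qed.

Let O_Gamma : O `<=` Gamma.
Proof. by rewrite attractor_eq_closure; exact: subset_closure. Qed.

Lemma rho_lower_bound : exists p, [/\ 0 < p, p <= 1 & forall m, p <= rho m].
Proof. by apply: finite_pos_lower_bound => m; have [] := sim m. Qed.

(** A tile of size about r through x, with r measured in units of the diameter
bound D of Gamma, lies in the ball and contains a scaled copy of a fixed ball
of O. *)
Lemma ball_in_open_set : exists2 eta : R, 0 < eta < 1 &
  forall x r, Gamma x -> 0 < r <= 1 ->
    exists y, eball y (eta * r) `<=` eball x r `&` O.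
Proof.
have [p [p0 p1 prho]] := rho_lower_bound.
have [D D1 hD] := bounded_distance bddG bddG.
have D0 : 0 < D by lra.
have [b Ob] := O_neq0.
have /nbhs_eballP[r0 r00 r0O] : nbhs b O by exact: open_nbhs_nbhs.
pose r1 := Num.min r0 2^-1.
have r10 : 0 < r1 by rewrite lt_min r00 invr_gt0 ltr0n.
have r1lt : r1 < 1 by rewrite gt_min invf_lt1 ?ltr1n// orbT.
have r1O : eball b r1 `<=` O.
  by move=> y yb; apply: r0O; apply: le_trans yb _; rewrite ge_min lexx.
have pD : 0 < p / D <= 1 by rewrite divr_gt0// ler_pdivrMr//; lra.
case/andP: pD => pD0 pD1.
exists (p / D * r1); first by rewrite mulr_gt0//=; nra.
move=> x r Gx /andP[rpos r_le1].
have rD : 0 < r / D <= 1 by rewrite divr_gt0//= ler_pdivrMr//; lra.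
have p01 : 0 <= p <= 1 by rewrite ltW.
have [w [x' Gx' <-] /andP[wl wr]] := word_stop sim rho_lt1 Gammas p01 prho rD Gx.
have wsim := word_similarity sim w.
exists (word_map s w b) => z zb.
have : (word_map s w @` eball b r1) z.
  rewrite (similarity_ball _ _ wsim); apply: le_trans zb _.
  by rewrite [leLHS]mulrAC ler_wpM2r ?(ltW r10)//; apply: le_trans wl; lra.
move=> [z' /r1O Oz' <-]; split; last first.
  by apply: (word_map_stable sO (w := w)); exists z'.
have [w0 we] := wsim; rewrite /eball/= we.
apply: (@le_trans _ _ (r / D * D)); last by rewrite divfK// gt_eqF.
apply: ler_pM => //; [exact: ltW|exact: enorm_ge0|].
by apply: hD => //; exact: O_Gamma.
Qed.

Lemma exists_far_point : exists y, ~ Gamma y.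
Proof.
have [C _ GC] := ex_strict_bound_gt0 bddG.
exists (const_mx C) => /GC/=; apply/negP; rewrite -leNgt.
have : `|(const_mx C : 'rV[R]_n) ord0 (Ordinal n_gt0)| <= `|const_mx C : 'rV[R]_n|.
  by apply/norm_rV_leP.
by rewrite mxE; apply: le_trans; exact: ler_norm.
Qed.

Lemma complement_porous : E_porous (~` Gamma).
Proof.
have [y0 ny0] := exists_far_point; have [g Gg] := Gamma_neq0.
split.
- by split; [exact: closed_openC|exists y0].
- by move=> e; have : (~` Gamma) g by rewrite e.
have [eta eta01 ball] := ball_in_open_set; exists eta => //.
move=> x r [_ nix] /andP[r0 r1].
have Gx : Gamma x by move: nix; rewrite interiorC => /contrapT/closedG.
have [|y yO] := ball x r Gx; first by rewrite r0 ltW.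
exists y => [z /yO[]//|]; rewrite predeqE => z; split=> // -[/yO[_ Oz] clz].
have : (O `&` closure (~` Gamma)) z by [].
rewrite open_disjoint_closure// predeqE => u; split=> // -[Ou]; apply.
exact: O_Gamma.
Qed.

(** Small tiles around a point of O. *)
Lemma tile_in_open_set : exists w, word_map s w @` Gamma `<=` O.
Proof.
have [D D1 hD] := bounded_distance bddG bddG.
have D0 : 0 < D by lra.
have [b Ob] := O_neq0.
have /nbhs_eballP[r0 r00 r0O] : nbhs b O by exact: open_nbhs_nbhs.
have r1 : 0 < Num.min 1 (r0 / D) <= 1.
  by rewrite lt_min ltr01 divr_gt0// ge_min lexx.
have := word_stop (p := 0) sim rho_lt1 Gammas _ _ r1 (O_Gamma Ob).
case=> [|m|w [b' Gb' bE] /andP[_ wr]].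
- by rewrite lexx ler01.
- by have [/ltW] := sim m.
exists w => _ [x Gx <-]; apply: r0O; rewrite -bE /eball/=.
have [w0 ->] := word_similarity sim w.
apply: (@le_trans _ _ (r0 / D * D)); last by rewrite divfK// gt_eqF.
apply: ler_pM => //; [exact: ltW|exact: enorm_ge0| |exact: hD].
by apply: le_trans wr _; rewrite ge_min lexx orbT.
Qed.

(** If all the tiles of words v <> w of this length missed s_w(x), so would
a neighbourhood of s_w(x), as they are finitely many closed sets. Since O is
covered by the tiles, s_w(Gamma) alone would cover a neighbourhood of s_w(x),
and x would be interior to Gamma. *)
Lemma neighbour_tile w x : word_map s w @` Gamma `<=` O ->
    Gamma x -> ~ interior Gamma x ->
  exists v, [/\ size v = size w, v <> w &
    (word_map s v @` Gamma) (word_map s w x)].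
Proof.
move=> wO Gx nix; apply: contrapT => none.
pose k := size w.
pose F := \bigcup_(v in [set v : k.-tuple 'I_M | tval v <> w])
  (word_map s v @` Gamma).
have clF : closed F.
  apply: closed_bigcup => [|v _]; first exact: finite_finset.
  by apply: similarity_closed (word_similarity sim v) _.
have nF : ~ F (word_map s w x).
  by move=> [v vw vx]; apply: none; exists v; split=> //; exact: size_tuple.
have nb : nbhs (word_map s w x) (O `&` ~` F).
  apply: open_nbhs_nbhs; split; last by split => //; apply: wO; exists x.
  by apply: openI => //; exact: closed_openC.
have nbx : nbhs x (word_map s w @^-1` (O `&` ~` F)).
  exact: (similarity_continuous (word_similarity sim w)).
apply: nix; apply: filterS nbx => y [Oy nFy].
have [v vk [z Gz zy]] := word_cover k Gammas (O_Gamma Oy).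
have [vw|vw] := pselect (v = w).
  have [h [hK _ _]] := similarity_inverse (word_similarity sim w).
  by rewrite -(hK y) -zy vw hK.
exfalso; apply: nFy; exists (Tuple (introT eqP vk)) => //; by exists z.
Qed.

(** The copy of Gamma at x is T(Gamma) with T = s_w^-1 s_v. The ball is sought
in T(O), which avoids Gamma because s_v(O) avoids s_w(O) and its closure.
The map T has ratio rho_v / rho_w, possibly larger than 1; taking the ball at
scale rho_w r in Gamma turns it into one at scale rho_v r at x, where
p^|w| <= rho_v <= 1. *)
Lemma interior_porous : E_porous (interior Gamma).
Proof.
have [y0 ny0] := exists_far_point; have [b Ob] := O_neq0.
have Oint : O `<=` interior Gamma.
  by move=> x Ox; apply: filterS O_Gamma _; exact: open_nbhs_nbhs.
split.
- by split; [exact: open_interior|exists b; exact: Oint].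
- by move=> e; apply: ny0; apply: interior_subset; rewrite e.
have [p [p0 p1 prho]] := rho_lower_bound.
have [w wO] := tile_in_open_set.
have [eta /andP[eta0 eta1] ball] := ball_in_open_set.
have pk0 : 0 < p ^+ size w by rewrite exprn_gt0.
have pk1 : p ^+ size w <= 1 by rewrite exprn_ile1// ltW.
exists (p ^+ size w * eta); first by rewrite mulr_gt0//=; nra.
move=> x r [clx nix] /andP[r0 r1].
have Gx : Gamma x.
  by apply: closedG; apply: closure_subset clx; exact: interior_subset.
have {}nix : ~ interior Gamma x.
  move=> ix; apply: nix.
  by rewrite (interior_id _).1//; exact: open_interior.
have [v [vk vw [x' Gx' xx']]] := neighbour_tile wO Gx nix.
have [h [hK Kh hsim]] := similarity_inverse (word_similarity sim w).
have vsim := word_similarity sim v.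
have w0 := (word_similarity sim w).1; have w1 := word_ratio_le1 sim rho_lt1 w.
have v1 := word_ratio_le1 sim rho_lt1 v.
have vp := word_ratio_ge v (ltW p0) prho.
pose T := h \o word_map s v.
have Tsim : similarity ((word_ratio rho w)^-1 * word_ratio rho v) T.
  exact: similarity_comp.
have Tx : T x' = x by rewrite /T/= xx' hK.
have ratioE t : (word_ratio rho w)^-1 * word_ratio rho v * (t * (word_ratio rho w * r))
    = word_ratio rho v * (t * r) by field; rewrite gt_eqF.
have [|y' y'O] := ball x' (word_ratio rho w * r) Gx'.
  by rewrite mulr_gt0//= mulr_ile1// ltW.
have sub : eball (T y') (p ^+ size w * eta * r) `<=`
    T @` (eball x' (word_ratio rho w * r) `&` O).
  move=> z zy.
  suff : (T @` eball y' (eta * (word_ratio rho w * r))) z by exact: image_subset.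
  rewrite (similarity_ball _ _ Tsim).
  have er0 : 0 <= eta * r by rewrite mulr_ge0// ltW.
  by apply: le_trans zy _; rewrite ratioE -mulrA ler_wpM2r// -vk.
exists (T y') => [z /sub[u [ux _] <-]|].
  have : (T @` eball x' (word_ratio rho w * r)) (T u) by exists u.
  rewrite (similarity_ball _ _ Tsim) Tx -[_ * r]mul1r ratioE mul1r => /le_trans; apply.
  by rewrite ler_piMl// ltW.
rewrite predeqE => z; split=> // -[/sub[u [_ Ou] <-] clz].
have GT : Gamma (T u).
  by apply: closedG; apply: closure_subset clz; exact: interior_subset.
have : (word_map s v @` O `&` closure (word_map s w @` O)) (word_map s v u).
  split; first by exists u.
  apply: (image_closure_subset (word_similarity sim w)); exists (T u).
    by rewrite -attractor_eq_closure.
  by rewrite /T/= Kh.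
rewrite open_disjoint_closure//; first exact: similarity_open vsim openO.
rewrite predeqE => q; split=> // -[[a Oa aq] [c Oc cq]]; apply: vw.
by apply: (word_disjoint sim sO disjO Oa Oc vk); rewrite aq cq.
Qed.

End Porosity.

Theorem corollary2p9 (R : realType) (n : nat) (Gamma : set 'rV[R]_n)
    (hGamma : n_attractor Gamma) :
  E_porous (interior Gamma) /\ E_porous (~` Gamma).
Proof.
case: hGamma => M [rho [s [[M2 hs] [G0 cG GE] [V [V0 bV oV sV dV]] sum1]]].
have sim m : similarity (rho m) (s m).
  by have [/andP[rho0 _] h] := hs m.
have rho1 m : rho m < 1 by have [/andP[_ lt1] _] := hs m.
(* In dimension 0 the volume identity would read M = 1. *)
have n0 : (0 < n)%N.
  rewrite lt0n; apply/eqP => n0.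
  have : \sum_(m < M) rho m ^+ n = M%:R.
    by rewrite n0 (eq_bigr (fun=> 1)) ?sumr_const ?card_ord.
  by rewrite sum1 => /esym/eqP; rewrite pnatr_eq1 => /eqP M1; rewrite M1 in M2.
have bG := compact_bounded cG.
have clG : closed Gamma by apply: compact_closed cG; exact: norm_hausdorff.
split.
  exact: (interior_porous sim rho1 n0 sum1 V0 bV oV sV dV G0 bG clG GE).
exact: (complement_porous sim rho1 n0 sum1 V0 bV oV sV dV G0 bG clG GE).
Qed.
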